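(* Let $n\geq 1$. Let $c_1(n)$ be the number of partitions of $n$ in which one part occurs exactly three times and all other parts occur exactly once. Let $b_1(n)$ be the total number of parts in all partitions of $n$ into distinct parts minus the total number of different parts in all partitions of $n$ into odd parts, where in each partition into odd parts every distinct part value is counted once, regardless of its multiplicity. Then $c_1(n)=b_1(n)$.
   Context: A partition of $n$ is a non-increasing sequence of positive integers (its parts) summing to $n$. *)

(* Defs.v *)
From HB Require Import structures.
From mathcomp Require Import all_boot all_order all_algebra.

Set Implicit Arguments.
Unset Strict Implicit.
Unset Printing Implicit Defensive.

Import GRing.Theory.

Definition is_part (n : nat) (s : seq nat) : bool :=
  [&& sorted geq s, all (fun k => 0 < k) s & sumn s == n].

Record intpart (n : nat) : Type := IntPart {
  parts :> seq nat;
  partsP : is_part n parts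
}.

HB.instance Definition _ n := [isSub for @parts n].
HB.instance Definition _ n := [Countable of intpart n by <:].

(* A partition of n has at most n parts, each at most n, so it embeds in a
   finite type of bounded sequences; this is only used to get finiteness. *)
Lemma is_part_size n s : is_part n s -> size s <= n.
Proof.
case/and3P=> _ pos_s /eqP <-.
elim: s pos_s => //= k s IHs /andP[k_gt0 /IHs].
by rewrite -add1n; apply: leq_add.
Qed.

Lemma is_part_le n s k : is_part n s -> k \in s -> k <= n.
Proof.
case/and3P=> _ _ /eqP <-.
elim: s => //= j s IHs; rewrite inE => /predU1P[->|/IHs /leq_trans-> //].
  exact: leq_addr.
exact: leq_addl.
Qed.

Section Finite.
Variable n : nat.

Fact intpart_bseq_proof (p : intpart n) :
  size [seq inord k : 'I_n.+1 | k <- p] <= n.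
Proof. by rewrite size_map is_part_size ?partsP. Qed.

Definition bseq_of_intpart (p : intpart n) : n.-bseq 'I_n.+1 :=
  Bseq (intpart_bseq_proof p).

Definition intpart_of_bseq (t : n.-bseq 'I_n.+1) : option (intpart n) :=
  insub [seq nat_of_ord i | i <- t].

Lemma bseq_of_intpartK : pcancel bseq_of_intpart intpart_of_bseq.
Proof.
move=> p; rewrite /intpart_of_bseq /= -map_comp.
rewrite (_ : map _ _ = parts p) ?valK //.
rewrite -[RHS]map_id; apply/eq_in_map => k pk /=.
by rewrite inordK // ltnS (is_part_le (partsP p) pk).
Qed.

HB.instance Definition _ : isFinite (intpart n) :=
  PCanIsFinite bseq_of_intpartK.
End Finite.

Definition one_part_thrice (s : seq nat) : bool :=
  has (fun k => (count_mem k s == 3) &&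
                all (fun j => (j != k) ==> (count_mem j s == 1)) s) s.

Definition c1 (n : nat) : nat := #|[set p : intpart n | one_part_thrice p]|.

(* Integer-valued, since natural-number subtraction would truncate. *)
Definition b1 (n : nat) : int :=
  ((\sum_(p : intpart n | uniq p) size p)%N%:Z
   - (\sum_(p : intpart n | all odd p) size (undup p))%N%:Z)%R.

(* Main.v *)
(* Write D(q) = prod_j (1 + q^j).  Marking the part k that is counted, the
   generating functions are
     c_1            : sum_k q^(3k) D / (1 + q^k),
     distinct parts : sum_k q^k D / (1 + q^k),
     odd parts      : sum_(k odd) q^k D,  by Euler's theorem.
   Since (q^k - q^(3k)) / (1 + q^k) = q^k - q^(2k), the first two differ by
   sum_k (q^k - q^(2k)) D, where the terms with k even cancel.  Power series
   are replaced by polynomials compared up to degree n. *)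
Require Import Defs.
From mathcomp Require Import all_boot all_order all_algebra.
From mathcomp Require Import ring zify.

Set Implicit Arguments.
Unset Strict Implicit.
Unset Printing Implicit Defensive.

Import GRing.Theory.

(** * Partitions as vectors of multiplicities *)

Lemma big_seq_count_mem n (s : seq nat) (F : nat -> nat) :
  {in s, forall x, 0 < x <= n} ->
  \sum_(x <- s) F x = \sum_(k < n) count_mem k.+1 s * F k.+1.
Proof.
elim: s => [|x s IHs] s_n; first by rewrite big_nil big1.
rewrite big_cons IHs => [|y sy]; last by rewrite s_n ?inE ?sy ?orbT.
have /andP[x_gt0 x_le] := s_n x (mem_head x s).
have lt_xn : x.-1 < n by rewrite prednK.
rewrite (bigD1 (Ordinal lt_xn)) //= [RHS](bigD1 (Ordinal lt_xn)) //=.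
rewrite prednK // eqxx mulnDl mul1n addnA; congr (_ + _).
apply: eq_bigr => k ne_kx; case: eqP => // x_k.
by case/eqP: ne_kx; apply: val_inj; rewrite /= x_k.
Qed.

Section Partitions.
Variable n : nat.
Implicit Type p : intpart n.

Lemma part_bounds p x : x \in parts p -> 0 < x <= n.
Proof.
move=> px; rewrite (is_part_le (partsP p)) // andbT.
by case/and3P: (partsP p) => _ /allP/(_ x px).
Qed.

Lemma count_part_le p x : count_mem x p <= n.
Proof. exact: leq_trans (count_size _ _) (is_part_size (partsP p)). Qed.

Lemma intpart_eq p1 p2 :
  (forall k : 'I_n, count_mem k.+1 p1 = count_mem k.+1 p2) -> p1 = p2.
Proof.
move=> eq_cnt; apply: val_inj => /=.
have geqT : transitive geq by move=> y x z /= ? ?; lia.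
have geqA : antisymmetric geq by move=> x y /= ?; lia.
apply: (sorted_eq geqT geqA);
  do ?[by case/and3P: (partsP p1)|by case/and3P: (partsP p2)].
apply/allP => x; rewrite mem_cat => px.
have /andP[x_gt0 x_le] : 0 < x <= n by case/orP: px => /part_bounds.
have lt_xn : x.-1 < n by rewrite prednK.
by have /= := eq_cnt (Ordinal lt_xn); rewrite prednK // => ->.
Qed.

(** Concatenating [f k] copies of each [k.+1] and sorting gives the partition. Together with
    [intpart_eq], this identifies partitions of [n] with multiplicity vectors of weight [n]. *)
Lemma intpart_of_counts (f : 'I_n -> nat) :
  \sum_(k < n) f k * k.+1 = n ->
  exists p, forall k : 'I_n, count_mem k.+1 p = f k.
Proof.
move=> sum_f.
pose s := flatten [seq nseq (f k) k.+1 | k <- enum 'I_n].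
have s_part : is_part n (sort geq s).
  apply/and3P; split; first by apply: sort_sorted => x y /=; lia.
    rewrite all_sort; apply/allP => x /flatten_mapP[k _].
    by rewrite mem_nseq => /andP[_ /eqP->].
  rewrite (perm_sumn (permEl (perm_sort _ _))) sumn_flatten -map_comp sumnE.
  rewrite big_map big_enum /= -[X in _ == X]sum_f; apply/eqP.
  by apply: eq_bigr => k _; rewrite /= sumn_nseq mulnC.
exists (IntPart s_part) => k /=.
rewrite (permP (permEl (perm_sort _ _))) count_flatten -map_comp sumnE.
rewrite big_map big_enum (bigD1 k) //= count_nseq /= eqxx mul1n.
rewrite big1 ?addn0 // => j ne_jk; rewrite count_nseq /= eqSS.
by rewrite (inj_eq val_inj) (negbTE ne_jk).
Qed.

(** Each multiplicity is constrained independently of the others, so the generating function is a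
    product over the parts. *)
Definition num_mult (A : 'I_n -> pred nat) : nat :=
  #|[pred p : intpart n | [forall k : 'I_n, A k (count_mem k.+1 p)]]|.

(** Expanding the product chooses a multiplicity for every part, and the coefficient of ['X^n]
    counts the choices of total weight [n]. The cutoff [N] loses nothing, since no multiplicity
    exceeds [n]. *)
Lemma num_mult_coef (R : comNzRingType) N (A : 'I_n -> pred nat) :
  n <= N ->
  ((num_mult A)%:R =
   (\prod_(k < n) \sum_(i < N.+1 | A k i) 'X^(i * k.+1))`_n :> R)%R.
Proof.
move=> le_nN; rewrite bigA_distr_big_dep coef_sum.
under eq_bigr => f _ do rewrite prodrXr coefXn.
rewrite -natr_sum -big_mkcondr sum1_card; congr (_%:R)%R.
(* Partitions are matched with the choice functions of the expanded product; [inord] is faithful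
   here because multiplicities are at most [n <= N]. *)
pose mult p : {ffun 'I_n -> 'I_N.+1} :=
  [ffun k : 'I_n => inord (count_mem k.+1 p)].
have multE p k : mult p k = count_mem k.+1 p :> nat.
  by rewrite ffunE inordK // ltnS (leq_trans (count_part_le p _)).
have mult_inj : injective mult.
  by move=> p1 p2 eq_m; apply: intpart_eq => k; rewrite -!multE eq_m.
rewrite /num_mult -(card_image mult_inj).
apply: eq_card => f; rewrite [RHS]unfold_in.
apply/imageP/andP => [[p /forallP Ap ->]|[/familyP Af /eqP sum_f]].
  split; first by apply/familyP => k; rewrite unfold_in multE; apply: Ap.
  under eq_bigr => k _ do rewrite multE.
  rewrite -(@big_seq_count_mem n p id) => [|x]; last exact: part_bounds.
  by rewrite -sumnE eq_sym; case/and3P: (partsP p).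
have [p p_f] := intpart_of_counts (esym sum_f).
exists p.
  by apply/forallP => k; rewrite p_f; have:= Af k; rewrite unfold_in.
by apply/ffunP => k; apply: val_inj; rewrite /= multE p_f.
Qed.

(** * The three counts as sums over a marked part *)

Lemma mem_part_ord p x : x \in parts p -> exists k : 'I_n, x = k.+1.
Proof.
move=> /part_bounds/andP[x_gt0 x_le].
have lt_xn : x.-1 < n by rewrite prednK.
by exists (Ordinal lt_xn); rewrite /= prednK.
Qed.

Lemma uniq_part_count p : uniq p = [forall k : 'I_n, count_mem k.+1 p <= 1].
Proof.
apply/idP/forallP => [p_uniq k|le1]; first by rewrite count_uniq_mem ?leq_b1.
apply: count_mem_uniq => x; case: (boolP (x \in _)) => [px|/count_memPn//].
have [k def_x] := mem_part_ord px.
by apply/eqP; rewrite eqn_leq -has_count has_pred1 px andbT def_x le1.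
Qed.

Lemma size_undup_part p : size (undup p) = \sum_(k < n) (k.+1 \in parts p).
Proof.
rewrite -sum1_size (@big_seq_count_mem n _ (fun=> 1)).
  by apply: eq_bigr => k _; rewrite muln1 count_uniq_mem ?undup_uniq ?mem_undup.
by move=> x; rewrite mem_undup; apply: part_bounds.
Qed.

Definition thrice_at (k j : 'I_n) : pred nat :=
  fun i => if j == k then i == 3 else i <= 1.

Definition once_at (k j : 'I_n) : pred nat :=
  fun i => if j == k then i == 1 else i <= 1.

(** For [k.+1] even the two demands contradict each other at [j = k], so even marked parts
    contribute nothing. *)
Definition odd_with (k j : 'I_n) : pred nat :=
  fun i => ((j == k) ==> (0 < i)) && (odd j.+1 || (i == 0)).

(** At most one term is nonzero: the part occurring three times is unique, as any other marked index
    would force its multiplicity to be at most 1. *)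
Lemma one_part_thrice_sum p :
  one_part_thrice p =
  \sum_(k < n) [forall j, thrice_at k j (count_mem j.+1 p)] :> nat.
Proof.
have thriceP (k : 'I_n) :
    [forall j, thrice_at k j (count_mem j.+1 p)] =
    (count_mem k.+1 p == 3) &&
    all (fun j => (j != k.+1) ==> (count_mem j p == 1)) p.
  apply/forallP/andP => [Ap|[p3 /allP p1] j].
    split; first by have:= Ap k; rewrite /thrice_at eqxx.
    apply/allP => x px; apply/implyP; have [j def_x] := mem_part_ord px.
    rewrite def_x in px *; rewrite eqSS (inj_eq val_inj) => ne_jk; have:= Ap j.
    rewrite /thrice_at (negbTE ne_jk) => le1; rewrite eqn_leq le1.
    by rewrite /= -has_count has_pred1.
  rewrite /thrice_at; case: eqP => [->//|/eqP ne_jk].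
  have [/p1|/count_memPn->//] := boolP (j.+1 \in parts p).
  by rewrite eqSS (inj_eq val_inj) ne_jk => /eqP->.
rewrite /one_part_thrice; case: hasP => [[x px]|no_thrice].
  have [k ->] := mem_part_ord px; rewrite -thriceP => Ak.
  rewrite (bigD1 k) //= Ak big1 // => j ne_jk; apply/eqP; rewrite eqb0.
  apply/negP => /forallP/(_ k); move/forallP/(_ k): Ak.
  by rewrite /thrice_at eqxx (eq_sym k) (negbTE ne_jk) => /eqP->.
rewrite big1 // => k _; apply/eqP; rewrite eqb0 thriceP.
apply/negP => Ak; case: no_thrice; exists k.+1 => //.
by case/andP: Ak => /eqP p3 _; rewrite -has_pred1 has_count p3.
Qed.

Lemma c1_num_mult : c1 n = \sum_(k < n) num_mult (thrice_at k).
Proof.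
rewrite /c1 cardsE -sum1_card big_mkcond /=.
under eq_bigr => p _ do
  rewrite (_ : (if _ then _ else _) = one_part_thrice p :> nat) //
          one_part_thrice_sum.
rewrite exchange_big; apply: eq_bigr => k _.
by rewrite /num_mult -sum1_card [RHS]big_mkcond.
Qed.

(** Double counting of the pairs formed by a partition and one of its parts. *)
Lemma uniq_parts_num_mult :
  \sum_(p : intpart n | uniq p) size p = \sum_(k < n) num_mult (once_at k).
Proof.
have onceP p (k : 'I_n) : uniq p && (k.+1 \in parts p) =
    [forall j, once_at k j (count_mem j.+1 p)].
  rewrite uniq_part_count -has_pred1 has_count /once_at.
  apply/andP/forallP => [[/forallP le1 pk] j|Ap].
    by case: eqP => // ->; rewrite eqn_leq le1.
  have pk := Ap k; rewrite eqxx in pk; rewrite (eqP pk); split=> //.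
  apply/forallP => j; have:= Ap j; case: eqP => // _ /eqP -> //.
transitivity (\sum_(p : intpart n) \sum_(k < n) (uniq p && (k.+1 \in parts p))).
  rewrite big_mkcond; apply: eq_bigr => p _.
  case: ifP => p_uniq; last by rewrite big1.
  by rewrite -[in LHS](undup_id p_uniq) size_undup_part.
rewrite exchange_big; apply: eq_bigr => k _.
rewrite /num_mult -sum1_card [RHS]big_mkcond; apply: eq_bigr => p _ /=.
by rewrite onceP inE; case: ifP.
Qed.

Lemma odd_parts_num_mult :
  \sum_(p : intpart n | all odd p) size (undup p) =
  \sum_(k < n) num_mult (odd_with k).
Proof.
have oddP p (k : 'I_n) : all odd p && (k.+1 \in parts p) =
    [forall j, odd_with k j (count_mem j.+1 p)].
  rewrite -has_pred1 has_count /odd_with.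
  apply/andP/forallP => [[/allP p_odd pk] j|Ap].
    apply/andP; split; first by apply/implyP => /eqP->.
    have [/p_odd->//|/count_memPn->] := boolP (j.+1 \in parts p).
    by rewrite orbT.
  split; last by have:= Ap k; rewrite eqxx => /andP[].
  apply/allP => x px; have [j def_x] := mem_part_ord px.
  have /andP[_] := Ap j; rewrite -def_x => /orP[//|/eqP/count_memPn].
  by rewrite px.
transitivity
  (\sum_(p : intpart n) \sum_(k < n) (all odd p && (k.+1 \in parts p))).
  rewrite big_mkcond; apply: eq_bigr => p _.
  by case: ifP => p_odd; [rewrite size_undup_part | rewrite big1].
rewrite exchange_big; apply: eq_bigr => k _.
rewrite /num_mult -sum1_card [RHS]big_mkcond; apply: eq_bigr => p _ /=.
by rewrite oddP inE; case: ifP.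
Qed.

End Partitions.

(** * Power series truncated after degree [n] *)

Local Open Scope ring_scope.

Lemma big_double_even (T : Type) (idx : T) (op : Monoid.com_law idx)
    (F : nat -> T) n :
  \big[op/idx]_(1 <= j < n.*2.+1 | ~~ odd j) F j =
  \big[op/idx]_(1 <= j < n.+1) F j.*2.
Proof.
elim: n => [|n IHn]; first by rewrite !big_geq.
rewrite [in RHS]big_nat_recr //= -IHn doubleS.
rewrite big_mkcond big_nat_recr //= big_nat_recr //= -big_mkcond /=.
by rewrite odd_double /= Monoid.mulm1.
Qed.

Section Truncation.
Variables (R : comNzRingType) (n : nat).
Implicit Types p q r : {poly R}.

(** Congruence modulo ['X^n.+1]. *)
Definition eqtrunc p q := forall i, (i <= n)%N -> p`_i = q`_i.
Local Notation "p =t q" := (eqtrunc p q) (at level 70, no associativity).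

Lemma eqtrunc_sym p q : p =t q -> q =t p.
Proof. by move=> pq i /pq. Qed.

Lemma eqtrunc_trans q p r : p =t q -> q =t r -> p =t r.
Proof. by move=> pq qr i le_in; rewrite pq ?qr. Qed.

Lemma eqtruncD p1 q1 p2 q2 : p1 =t q1 -> p2 =t q2 -> p1 + p2 =t q1 + q2.
Proof. by move=> pq1 pq2 i le_in; rewrite !coefD pq1 ?pq2. Qed.

Lemma eqtruncN p q : p =t q -> - p =t - q.
Proof. by move=> pq i le_in; rewrite !coefN pq. Qed.

Lemma eqtruncM p1 q1 p2 q2 : p1 =t q1 -> p2 =t q2 -> p1 * p2 =t q1 * q2.
Proof.
move=> pq1 pq2 i le_in; rewrite !coefM; apply: eq_bigr => j _.
have le_ji : (j <= i)%N by rewrite -ltnS.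
by rewrite pq1 ?pq2 ?(leq_trans le_ji) // (leq_trans (leq_subr _ _)).
Qed.

Lemma eqtruncXn m : (n < m)%N -> 'X^m =t 0.
Proof.
by move=> lt_nm i le_in; rewrite coefXn coef0 ltn_eqF // (leq_ltn_trans le_in).
Qed.

(** The doubles of [1..n] are the even numbers up to [2n], and those above [n] contribute only the
    neutral element modulo ['X^n.+1]. Stated for a general [op] to serve both Euler's product and
    the cancelling sum. *)
Lemma eqtrunc_big_even idx (op : Monoid.com_law idx) (F : nat -> {poly R}) :
  (forall p1 q1 p2 q2, p1 =t q1 -> p2 =t q2 -> op p1 p2 =t op q1 q2) ->
  (forall j, (n < j)%N -> F j =t idx) ->
  \big[op/idx]_(1 <= j < n.+1) F j.*2 =t
  \big[op/idx]_(1 <= j < n.+1 | ~~ odd j) F j.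
Proof.
move=> op_t F_t; rewrite -big_double_even.
rewrite (@big_cat_nat _ _ _ n.+1) //=; last by rewrite ltnS -addnn leq_addr.
rewrite -[X in _ =t X](Monoid.mulm1 op); apply: (op_t) => //.
rewrite big_nat_cond; elim/big_rec: _ => // j p /andP[/andP[lt_nj _] _] p_t.
by rewrite -[X in _ =t X](Monoid.mulm1 op); apply: op_t; first exact: F_t.
Qed.

(** A truncation of the series of [1 / (1 - 'X^m)]. *)
Definition geom N m : {poly R} := \sum_(i < N.+1) 'X^(i * m).

(** The product telescopes to [1 - 'X^(m * N.+1)], and [m * N.+1] exceeds [n]. *)
Lemma geom_trunc N m : (0 < m)%N -> (n <= N)%N -> (1 - 'X^m) * geom N m =t 1.
Proof.
move=> m_gt0 le_nN; have -> : (1 - 'X^m) * geom N m = 1 - 'X^(m * N.+1).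
  rewrite exprM -[RHS]opprB subrX1 -mulNr opprB; congr (_ * _).
  by apply: eq_bigr => i _; rewrite mulnC exprM.
rewrite -[X in _ =t X]subr0; apply: eqtruncD => //; apply: eqtruncN.
by apply: eqtruncXn; rewrite mulnS; nia.
Qed.

Lemma prod_geom_trunc N (P : pred nat) : (n <= N)%N ->
  (\prod_(1 <= j < n.+1 | P j) (1 - 'X^j)) *
  (\prod_(1 <= j < n.+1 | P j) geom N j) =t 1.
Proof.
move=> le_nN; rewrite -big_split big_nat_cond /=.
elim/big_rec: _ => // j p /andP[/andP[j_gt0 _] _] p_t.
by rewrite -[X in _ =t X]mulr1; apply: eqtruncM => //; apply: geom_trunc.
Qed.

(** Euler's argument: multiplying the left side by all [1 - 'X^j] gives the product of all
    [1 - 'X^(j.*2)], which is congruent to the even factors alone. Cancelling these leaves the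
    inverse of the odd factors. *)
Lemma euler_odd_distinct N : (n <= N)%N ->
  \prod_(1 <= j < n.+1) (1 + 'X^j) =t \prod_(1 <= j < n.+1 | odd j) geom N j.
Proof.
move=> le_nN.
have := prod_geom_trunc odd le_nN.
have := prod_geom_trunc (fun j => ~~ odd j) le_nN.
set E := \prod_(_ <= _ < _ | _) (1 - _); set GE := \prod_(_ <= _ < _ | _) _.
set Od := \prod_(_ <= _ < _ | odd _) (1 - _).
set O := \prod_(_ <= _ < _ | _) geom _ _.
set D := \prod_(_ <= _ < _) _ => EGE OdO.
have OdED : Od * E * D =t E.
  have -> : Od * E * D = \prod_(1 <= j < n.+1) (1 - 'X^(j.*2)).
    have -> : Od * E = \prod_(1 <= j < n.+1) (1 - 'X^j).
      by rewrite [RHS](bigID odd).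
    rewrite -big_split; apply: eq_bigr => j _ /=.
    by rewrite -subr_sqr expr1n -exprM muln2.
  apply: (@eqtrunc_big_even _ _ (fun j => 1 - 'X^j)).
    exact: eqtruncM.
  move=> j lt_nj; rewrite -[X in _ =t X]subr0; apply: eqtruncD => //.
  by apply: eqtruncN; apply: eqtruncXn.
(* Division is replaced by inserting the truncated inverses: [Od * O] and [E * GE] are both
   congruent to 1. *)
apply: (@eqtrunc_trans (D * ((Od * O) * (E * GE)))).
  apply: eqtrunc_sym; rewrite -[X in _ =t X]mulr1 -[X in _ =t _ * X]mulr1.
  by do 2!apply: eqtruncM => //.
have -> : D * (Od * O * (E * GE)) = Od * E * D * (O * GE) by ring.
apply: (@eqtrunc_trans (E * (O * GE))); first exact: eqtruncM.
by rewrite mulrCA -[X in _ =t X]mulr1; apply: eqtruncM.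
Qed.

Lemma sum_even_trunc :
  \sum_(1 <= j < n.+1) ('X^j - 'X^(j.*2)) =t \sum_(1 <= j < n.+1 | odd j) 'X^j.
Proof.
rewrite sumrB (bigID odd) /= -[X in _ =t X]addr0 -addrA.
apply: eqtruncD => //.
rewrite -[X in _ =t X](subrr (\sum_(1 <= j < n.+1 | ~~ odd j) 'X^j)).
apply: eqtruncD => //; apply: eqtruncN.
apply: (@eqtrunc_big_even _ _ (fun j => 'X^j)); first exact: eqtruncD.
exact: eqtruncXn.
Qed.

End Truncation.

(** * Generating functions for a fixed marked part *)

Section Coefficients.
Variables (R : comNzRingType) (n : nat).
Implicit Type k : 'I_n.

(* Multiplicities range up to n + 3 so that 3 is in range for every n. *)
Let le_n3 : (n <= n.+3)%N. Proof. exact: (leq_addl 3). Qed.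

Lemma sum_mult_le1 m :
  \sum_(i < n.+4 | (i <= 1)%N) 'X^(i * m) = 1 + 'X^m :> {poly R}.
Proof. by rewrite big_mkcond !big_ord_recl /= mul0n mul1n big1 ?addr0. Qed.

Lemma sum_mult_eq c m : (c < n.+4)%N ->
  \sum_(i < n.+4 | i == c :> nat) 'X^(i * m) = 'X^(c * m) :> {poly R}.
Proof. by move=> lt_c; rewrite (big_pred1 (Ordinal lt_c)). Qed.

Lemma num_mult_exact_coef k (c : nat) (A : 'I_n -> pred nat) :
  (c <= 3)%N ->
  (forall j i, A j i = if j == k then i == c else (i <= 1)%N) ->
  (num_mult A)%:R =
  ('X^(c * k.+1) * \prod_(j < n | j != k) (1 + 'X^(j.+1)))`_n :> R.
Proof.
move=> le_c A_k; rewrite (@num_mult_coef _ _ n.+3) //.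
rewrite (bigD1 k) //=; congr ((_ * _ : {poly R})`_n).
  by rewrite -(@sum_mult_eq c) ?(leq_ltn_trans le_c) //;
     apply: eq_bigl => i; rewrite A_k eqxx.
apply: eq_bigr => j ne_jk; rewrite -sum_mult_le1.
by apply: eq_bigl => i; rewrite A_k (negbTE ne_jk).
Qed.

Local Notation D := (\prod_(1 <= j < n.+1) (1 + 'X^j) : {poly R}).

Lemma once_sub_thrice k :
  (num_mult (once_at k))%:R - (num_mult (thrice_at k))%:R =
  (('X^(k.+1) - 'X^(k.+1.*2)) * D)`_n :> R.
Proof.
rewrite (@num_mult_exact_coef k 1 (once_at k)) //.
rewrite (@num_mult_exact_coef k 3 (thrice_at k)) //.
rewrite -coefB -mulrBl.
have -> : D = (1 + 'X^(k.+1)) * \prod_(j < n | j != k) (1 + 'X^(j.+1)).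
  by rewrite big_add1 big_mkord (bigD1 k).
rewrite mulrA; congr ((_ * _ : {poly R})`_n).
(* With [x = 'X^(k.+1)], this is [x - x^3 = (x - x^2) * (1 + x)]. *)
by rewrite mul1n -muln2 mulnC !exprM; ring.
Qed.

Lemma sum_mult_odd (b : bool) m :
  \sum_(i < n.+4 | b || (i == 0%N :> nat)) 'X^(i * m) =
  if b then geom R n.+3 m else 1.
Proof. by case: b => //=; rewrite sum_mult_eq ?mul0n. Qed.

(** For [k.+1] odd, the marked part must occur, so its factor is a geometric series without constant
    term, that is, ['X^(k.+1)] times the full series. The factors then reassemble into the product
    over odd parts, which Euler's theorem turns into [D]. *)
Lemma odd_with_coef k :
  (num_mult (odd_with k))%:R = (if odd k.+1 then 'X^(k.+1) * D else 0)`_n :> R.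
Proof.
rewrite (@num_mult_coef _ _ n.+3) // (bigD1 k) //=.
case: ifPn => [k_odd|k_even]; last first.
  rewrite big1 ?mul0r // => i; rewrite /odd_with eqxx /= (negbTE k_even) /=.
  by case: eqP => [->|_]; rewrite ?andbF.
have -> : \sum_(i < n.+4 | odd_with k k i) 'X^(i * k.+1) =
    geom R n.+3 k.+1 - 1.
  rewrite /geom [X in _ = X - 1](bigD1 ord0) //= mul0n addrC addrK.
  apply: eq_bigl => i; rewrite /odd_with eqxx /= k_odd andbT.
  by rewrite lt0n.
have -> : \prod_(j < n | j != k) \sum_(i < n.+4 | odd_with k j i) 'X^(i * j.+1)
    = \prod_(j < n | odd j.+1 && (j != k)) geom R n.+3 j.+1.
  rewrite big_mkcondl; apply: eq_bigr => j ne_jk /=.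
  rewrite -sum_mult_odd; apply: eq_bigl => i.
  by rewrite /odd_with (negbTE ne_jk).
set Q := \prod_(_ < _ | _) _; set G := geom _ _ _.
have G_t : eqtrunc n (G - 1) ('X^(k.+1) * G).
  rewrite (_ : 'X^_ * G = G - (1 - 'X^(k.+1)) * G); last by ring.
  apply: eqtruncD => //; apply: eqtruncN; apply: eqtrunc_sym.
  by apply: geom_trunc.
rewrite (@eqtruncM _ n _ _ _ Q G_t) //.
rewrite -mulrA; symmetry; apply: (@eqtruncM _ n) => //.
apply: (@eqtrunc_trans _ _ (\prod_(1 <= j < n.+1 | odd j) geom R n.+3 j)).
  by apply: euler_odd_distinct.
by rewrite big_add1 big_mkord (bigD1 k).
Qed.

End Coefficients.

Local Close Scope ring_scope.

Theorem theorem2 (n : nat) (hn : 1 <= n) : ((c1 n)%:Z = b1 n)%R.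
Proof.
rewrite /b1 c1_num_mult uniq_parts_num_mult odd_parts_num_mult.
(* The equation is rearranged so that the distinct-part count minus [c1 n] stands alone on the left,
   ready for [once_sub_thrice]. *)
apply/eqP; rewrite eq_sym subr_eq addrC -subr_eq; apply/eqP.
rewrite -!natz !natr_sum -sumrB.
rewrite (eq_bigr _ (fun k _ => once_sub_thrice int k)).
rewrite [RHS](eq_bigr _ (fun k _ => odd_with_coef int k)).
rewrite -!coef_sum -big_mkcond -!mulr_suml.
(* Both sides are now coefficients of ['X^n] in multiples of the same product, so it suffices to
   compare the other factors modulo ['X^n.+1]. *)
have := @sum_even_trunc int n; rewrite !big_add1 !big_mkord => even_t.
exact: (eqtruncM even_t).
Qed.
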